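(* Let $\mathcal{A}=\{A_i\}_{i=1}^m$ with $A_i\in\mathbb{R}^{n\times n}$, and let $\tau_n$ be a partition of $n$. The exact general joint block diagonalization problem for $\mathcal{A}$ has a solution of the form $(\tau_n,W)$ (for some nonsingular $W\in\mathbb{R}^{n\times n}$) if and only if both of the following hold: there exists a matrix $Z\in\mathscr{N}(\mathcal{A})$ which has an eigenvalue partition $\zeta_n(Z)$ equivalent to $\tau_n$, and there is no $\widetilde{Z}\in\mathscr{N}(\mathcal{A})$ such that $\mathrm{card}(\zeta_n^{\mathrm{opt}}(\widetilde{Z}))>\mathrm{card}(\tau_n)$.
   Context: A partition of a positive integer $n$ is a tuple $\tau_n=(n_1,\dots,n_t)$ of positive integers with $\sum_i n_i=n$; its cardinality is $\mathrm{card}(\tau_n)=t$. Two partitions of $n$ with the same cardinality are equivalent if one is a permutation of the other. For a partition $\tau_n=(n_1,\dots,n_t)$, a matrix of order $n$ is $\tau_n$-block diagonal if it has the form $\mathrm{diag}(A_{11},\dots,A_{tt})$ with $A_{jj}$ of order $n_j$. Exact joint block diagonalization (JBD) problem for $\mathcal{A}$ and $\tau_n$: find a nonsingular $W\in\mathbb{R}^{n\times n}$ such that $W^TA_iW$ is $\tau_n$-block diagonal for all $i=1,\dots,m$. Exact general joint block diagonalization problem for $\mathcal{A}$: find a partition $\tau_n'$ of $n$ and a nonsingular $W$ that solves the JBD problem for $\mathcal{A}$ and $\tau_n'$, such that $\mathrm{card}(\tau_n')$ is the maximum of $\mathrm{card}(\tau_n)$ over all partitions $\tau_n$ of $n$ for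 which the JBD problem for $\mathcal{A}$ and $\tau_n$ has a solution. Such a pair $(\tau_n',W)$ is called a solution. The null space of $\mathcal{A}$ is $\mathscr{N}(\mathcal{A})=\{Z\in\mathbb{R}^{n\times n} : A_iZ=Z^TA_i,\ i=1,\dots,m\}$. Eigenvalue partition: for $Z\in\mathbb{R}^{n\times n}$, split the set of distinct (complex) eigenvalues of $Z$ into $s$ nonempty pairwise disjoint subsets, each closed under complex conjugation, and let $n_i$ be the sum of the algebraic multiplicities of the eigenvalues in the $i$-th subset. Then $\zeta_n(Z)=(n_1,\dots,n_s)$ is an eigenvalue partition of $Z$. The optimal eigenvalue partition $\zeta_n^{\mathrm{opt}}(Z)$ is the one (unique up to permutation) in which each subset is either a single real eigenvalue or a single pair $\{\lambda,\bar\lambda\}$ of non-real conjugate eigenvalues. *)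

(* Defs.v *)
From mathcomp Require Import all_boot all_order all_algebra.
From mathcomp Require Import reals complex.

Set Implicit Arguments.
Unset Strict Implicit.
Unset Printing Implicit Defensive.

Import Order.TTheory GRing.Theory Num.Theory.

Local Open Scope ring_scope.

Definition int_partition (n : nat) (tau : seq nat) : bool :=
  all (fun k => 0 < k)%N tau && (sumn tau == n).

(* [\mxdiag_j B j] has order [\sum_j nth 0 tau j], which equals [n] only
   propositionally when [tau] is a partition of [n]; hence the cast. *)
Definition block_diagonal (R : realType) (n : nat) (tau : seq nat)
    (M : 'M[R]_n) : Prop :=
  exists (e : (\sum_(j < size tau) nth 0 tau j)%N = n)
         (B : forall j : 'I_(size tau), 'M[R]_(nth 0%N tau j)),
    M = castmx (e, e) (\mxdiag_(j < size tau) B j).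

Definition jbd_solution (R : realType) (m n : nat) (A : 'I_m -> 'M[R]_n)
    (tau : seq nat) (W : 'M[R]_n) : Prop :=
  W \in unitmx /\ forall i, block_diagonal tau (W^T *m A i *m W).

Definition gjbd_solution (R : realType) (m n : nat) (A : 'I_m -> 'M[R]_n)
    (tau : seq nat) (W : 'M[R]_n) : Prop :=
  [/\ int_partition n tau,
      jbd_solution A tau W &
      forall tau', int_partition n tau' ->
        (exists W', jbd_solution A tau' W') -> (size tau' <= size tau)%N].

Definition null_space (R : realType) (m n : nat) (A : 'I_m -> 'M[R]_n)
    (Z : 'M[R]_n) : Prop :=
  forall i, A i *m Z = Z^T *m A i.

Definition complexify (R : realType) (n : nat) (Z : 'M[R]_n) : 'M[R[i]]_n :=
  map_mx (real_complex R) Z.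

Definition alg_mult (R : realType) (n : nat) (Z : 'M[R]_n) (x : R[i]) : nat :=
  mup x (char_poly (complexify Z)).

(* A splitting of the complex spectrum of [Z]; each subset is listed without
   repetition, and [uniq (flatten P)] expresses both this and the pairwise
   disjointness of the subsets. *)
Definition spectrum_split (R : realType) (n : nat) (Z : 'M[R]_n)
    (P : seq (seq R[i])) : Prop :=
  [/\ flatten P =i eigenvalue (complexify Z),
      uniq (flatten P),
      forall s, s \in P -> s != [::] &
      forall s, s \in P -> forall x, x \in s -> x^* \in s].

Definition block_multiplicities (R : realType) (n : nat) (Z : 'M[R]_n)
    (P : seq (seq R[i])) : seq nat :=
  [seq (\sum_(x <- s) alg_mult Z x)%N | s <- P].

Definition eigenvalue_partition (R : realType) (n : nat) (Z : 'M[R]_n)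
    (zeta : seq nat) : Prop :=
  exists2 P, spectrum_split Z P & zeta = block_multiplicities Z P.

Definition optimal_block (R : realType) (s : seq R[i]) : Prop :=
  (exists2 x, x \is Num.real & s =i [:: x]) \/
  (exists2 x, x \isn't Num.real & s =i [:: x; x^*]).

(* Determined by [Z] up to a permutation, so the relation stands for the
   function $\zeta_n^{opt}$ wherever only the cardinality matters. *)
Definition opt_eigenvalue_partition (R : realType) (n : nat) (Z : 'M[R]_n)
    (zeta : seq nat) : Prop :=
  exists P, [/\ spectrum_split Z P, forall s, s \in P -> optimal_block s &
                zeta = block_multiplicities Z P].

(* Main.v *)
Require Import Defs.
From mathcomp Require Import all_boot all_order all_fingroup all_algebra.
From mathcomp Require Import reals complex.
From mathcomp Require Import ring.

(** Let D_tau be the diagonal matrix whose i-th entry is the number of the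
    block of tau containing the index i.  A matrix is tau-block diagonal iff it
    commutes with D_tau, so W solves the block diagonalization problem for
    (A, tau) iff W D_tau W^-1 lies in the null space N(A).  Since the optimal
    eigenvalue partition of W D_tau W^-1 is tau, it remains to show that a
    matrix Z of N(A) with eigenvalue partition tau produces such a W.  Given the
    splitting S_0, ..., S_(t-1) of the spectrum, the Chinese remainder theorem
    yields a real polynomial g congruent to k modulo
    (\prod_(x in S_k) (X - x)(X - x^* ))^n for each k.  Then g(Z) is in N(A); it
    is annihilated by \prod_k (X - k), hence diagonalizable over R, and by
    spectral mapping k has multiplicity tau_k in its characteristic polynomial,
    so g(Z) = W D_tau W^-1 for some W. *)

Set Implicit Arguments.
Unset Strict Implicit.
Unset Printing Implicit Defensive.

Import Order.TTheory GRing.Theory Num.Theory.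

Local Open Scope ring_scope.

(** * Counting and permuting finite sequences *)

Lemma sum_count_mem (T : eqType) (s xs : seq T) : uniq s ->
  (\sum_(x <- s) count_mem x xs)%N = count [in s] xs.
Proof.
elim: s => [_|x s IHs] /=; first by rewrite big_nil; elim: xs.
case/andP=> xNs s_uniq; rewrite big_cons IHs // -count_predUI.
rewrite [X in (_ + X)%N](_ : _ = 0%N) ?addn0.
  by apply: eq_count => y; rewrite /= in_cons.
rewrite -(count_pred0 xs); apply: eq_count => y /=.
by case: eqVneq => //= ->; apply/negbTE.
Qed.

Lemma perm_eq_enum_perm (T : eqType) (n : nat) (d c : 'I_n -> T) :
  perm_eq [seq d i | i <- enum 'I_n] [seq c i | i <- enum 'I_n] ->
  exists s : 'S_n, forall i, d (s i) = c i.
Proof.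
move=> dc; have /tuple_permP[s Es]:
  perm_eq [tuple c i | i < n] [tuple d i | i < n] by rewrite perm_sym.
exists s => i.
have /(congr1 (fun t => tnth t i)) : [tuple c i | i < n] =
  [tuple tnth [tuple d j | j < n] (s i) | i < n] by apply: val_inj.
by rewrite !tnth_mktuple => ->.
Qed.

(** * Chinese remainders and vanishing of polynomials *)

Lemma poly_chinese (F : fieldType) (T : eqType) (s : seq T)
    (p a : T -> {poly F}) :
  uniq s -> {in s &, forall i j, i != j -> coprimep (p i) (p j)} ->
  exists g : {poly F}, {in s, forall i, p i %| g - a i}.
Proof.
elim: s => [|i s IHs] /=; first by exists 0.
case/andP=> iNs s_uniq cop.
have [|g gP] := IHs s_uniq.
  by move=> j k js ks; apply: cop; rewrite in_cons ?js ?ks orbT.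
have copi : coprimep (p i) (\prod_(j <- s) p j).
  rewrite big_seq; elim/big_rec: _ => [|j q js IHq]; first exact: coprimep1.
  rewrite coprimepMr IHq andbT cop ?in_cons ?eqxx ?js ?orbT //.
  by apply: contraNneq iNs => ->.
have /Bezout_eq1_coprimepP[[u v] /=] := copi.
move: (u : {poly F}) (v : {poly F}) => {}u {}v uv.
(* By Bezout, the factor [v * \prod_(j <- s) p j] is 1 modulo [p i] and 0 modulo every [p j] with j
   in [s]. The correction thus imposes the new congruence and preserves the others. *)
exists (g + (a i - g) * (v * \prod_(j <- s) p j)) => j.
rewrite in_cons => /predU1P[->|js].
  have -> : v * \prod_(j <- s) p j = 1 - u * p i.
    by apply/eqP; rewrite eq_sym subr_eq addrC uv.
  have -> : g + (a i - g) * (1 - u * p i) - a i = (g - a i) * u * p i by ring.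
  exact: dvdp_mull.
rewrite addrAC dvdp_add ?gP // !dvdp_mull // (big_rem j) //=.
exact: dvdp_mulr.
Qed.

(** The polynomial p - 1 takes only the value -1, so it has no root and is constant; hence p is
    constant as well. *)
Lemma poly_eq0_closed (F : closedFieldType) (p : {poly F}) :
  (forall x, p.[x] = 0) -> p = 0.
Proof.
move=> p0; have : size (p - 1) = 1%N.
  apply/eqP/negPn/negP => /closed_rootP[x /rootP].
  rewrite !hornerE p0 sub0r => /eqP; by rewrite oppr_eq0 oner_eq0.
move/eqP/size_poly1P => [c _ /(canRL (subrK _))].
rewrite -polyC1 -polyCD => Ep.
by have := p0 0; rewrite Ep hornerC => ->; rewrite polyC0.
Qed.

(** * Determinants and spectral mapping *)

Lemma horner_char_poly (R : comNzRingType) (n : nat) (Z : 'M[R]_n) (z : R) :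
  (char_poly Z).[z] = \det (z%:M - Z).
Proof.
rewrite /char_poly -horner_evalE -det_map_mx; congr (\det _).
apply/matrixP=> i j.
by rewrite !mxE /= /horner_eval hornerD hornerN hornerMn hornerX hornerC.
Qed.

(** Split p into linear factors: det(Z - z) is the product of x - z over the eigenvalues x, and
    exchanging the two products assembles the values of p. The leading coefficient enters once per
    eigenvalue. *)
Lemma det_horner_mx (F : closedFieldType) (n : nat) (Z : 'M[F]_n.+1)
    (xs : seq F) (p : {poly F}) :
  char_poly Z = \prod_(x <- xs) ('X - x%:P) ->
  \det (horner_mx Z p) = \prod_(x <- xs) p.[x].
Proof.
move=> Zxs.
have size_xs : size xs = n.+1.
  by apply/eqP; rewrite -eqSS -(size_prod_XsubC xs id) -Zxs size_char_poly.
have detXsubC z : \det (horner_mx Z ('X - z%:P)) = \prod_(x <- xs) (x - z).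
  rewrite rmorphB /= horner_mx_X horner_mx_C.
  have -> : Z - z%:M = - (z%:M - Z) by rewrite opprB.
  rewrite -scaleN1r detZ -horner_char_poly.
  rewrite Zxs horner_prod -size_xs.
  elim: (xs) => [|x s IHs] /=; first by rewrite !big_nil mulr1.
  by rewrite !big_cons -IHs exprS hornerXsubC mulrACA mulN1r opprB.
have [r {1 2}->] := closed_field_poly_normal p.
rewrite linearZ /= detZ rmorph_prod /= (big_morph _ (@det_mulmx _ _) (det1 _ _)).
rewrite (eq_bigr _ (fun z _ => detXsubC z)).
rewrite -size_xs; under [in RHS]eq_bigr do rewrite hornerZ horner_prod.
rewrite big_split /= exchange_big /=; congr (_ * _).
  by rewrite big_const_seq count_predT iter_mulr_1.
by apply: eq_bigr => z _; apply: eq_bigr => x _; rewrite hornerXsubC.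
Qed.

(** Spectral mapping with multiplicities. Both sides agree at every y, by the determinant formula
    applied to the polynomial y - g. *)
Lemma char_poly_horner_mx (F : closedFieldType) (n : nat) (Z : 'M[F]_n.+1)
    (xs : seq F) (g : {poly F}) :
  char_poly Z = \prod_(x <- xs) ('X - x%:P) ->
  char_poly (horner_mx Z g) = \prod_(x <- xs) ('X - (g.[x])%:P).
Proof.
move=> Zxs; apply/eqP; rewrite -subr_eq0; apply/eqP/poly_eq0_closed => y.
rewrite hornerD hornerN horner_prod; apply/eqP; rewrite subr_eq0; apply/eqP.
rewrite (eq_bigr (fun x => (y%:P - g).[x])); last first.
  by move=> x _; rewrite !hornerE.
by rewrite -(det_horner_mx _ Zxs) rmorphB /= horner_mx_C horner_char_poly.
Qed.

(** * Block-diagonal matrices as a commutant *)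

Lemma sum_nth_partition (n : nat) (tau : seq nat) :
  int_partition n tau -> (\sum_(j < size tau) nth 0 tau j)%N = n.
Proof.
case/andP=> _ /eqP <-; rewrite sumnE (big_nth 0%N) big_mkord.
by apply: eq_bigr.
Qed.

Section BlockStructure.

Variables (R : realType) (n : nat) (tau : seq nat).
Variable e : (\sum_(j < size tau) nth 0 tau j)%N = n.

Definition block_index (i : 'I_n) : 'I_(size tau) :=
  tagnat.sig1 (cast_ord (esym e) i).

(** This is the matrix D_tau. Different blocks get different diagonal entries because R has
    characteristic zero. *)
Definition block_label : 'M[R]_n := diag_mx (\row_i (block_index i)%:R).

(** The indices lying in block j are the image of the injective map [tagnat.Rank j], whose domain
    has the size of the block. *)
Lemma card_block_index (j : 'I_(size tau)) :
  #|[pred i | block_index i == j]| = nth 0%N tau j.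
Proof.
rewrite /block_index; case: n / e; rewrite -[RHS]card_ord.
have Rank_inj : injective (@tagnat.Rank (size tau) (nth 0%N tau) j).
  move=> k l /(congr1 val)/eqP; rewrite tagnat.eq_Rank eqxx => /eqP.
  exact: val_inj.
rewrite -(card_codom Rank_inj); apply: eq_card => i; rewrite !inE cast_ord_id.
apply/eqP/codomP => [<-|[k ->]]; last exact: tagnat.Rank1K.
by exists (tagnat.sig2 i); rewrite tagnat.sig2K.
Qed.

Lemma count_block_index (k : nat) :
  count_mem k [seq val (block_index i) | i <- enum 'I_n] = nth 0%N tau k.
Proof.
(* For k beyond the last block both sides are 0, the right one as the default value of [nth]. *)
rewrite count_map; case: (ltnP k (size tau)) => [kt|tk]; last first.
  rewrite nth_default //; apply/eqP; rewrite -leqn0 leqNgt -has_count.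
  apply/hasPn => i _ /=; rewrite neq_ltn (leq_trans _ tk) //.
by rewrite -(card_block_index (Ordinal kt)) cardE size_filter enumT; apply: eq_count.
Qed.

(** The entrywise criterion frees later arguments from the cast and the family of blocks. *)
Lemma block_diagonalP (M : 'M[R]_n) :
  block_diagonal tau M <->
  forall i j, block_index i != block_index j -> M i j = 0.
Proof.
split=> [[e' [B ->]] i j|M0].
  rewrite /block_index (eq_irrelevance e e').
  case: n / e' i j => i j /negbTE.
  by rewrite castmx_id !cast_ord_id /mxdiag mxE => ->; rewrite mxE.
exists e; move: M0; rewrite /block_index; case: n / e M => M M0.
exists (fun j => submxblock M j j); rewrite castmx_id -[LHS]submxblockK.
apply/eq_mxblockP => i j.
case: eqVneq => [->|nij]; first by rewrite conform_mx_id.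
by apply/matrixP => k l; rewrite !mxE M0 // !cast_ord_id !tagnat.Rank1K.
Qed.

(** Entry (i, j) of the commutator is [M i j] times the difference of the labels of i and j, which
    vanishes exactly when i and j share a block. *)
Lemma block_diagonal_comm (M : 'M[R]_n) :
  block_diagonal tau M <-> M *m block_label = block_label *m M.
Proof.
split=> [/block_diagonalP M0|MD].
  apply/matrixP => i j; rewrite mul_mx_diag mul_diag_mx !mxE mulrC.
  by case: (eqVneq (block_index i) (block_index j)) => [->//|/M0->]; rewrite !mulr0.
apply/block_diagonalP => i j bij; have /matrixP/(_ i j) := MD.
rewrite mul_mx_diag mul_diag_mx !mxE mulrC => /eqP.
rewrite -subr_eq0 -mulrBl mulf_eq0 subr_eq0 eqr_nat eq_sym => /orP[|/eqP//].
by move/eqP/val_inj => Eij; rewrite Eij eqxx in bij.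
Qed.

(** Multiplying the null space equation by W^T on the left and by W on the right turns it into
    commutation of W^T A_i W with D_tau, since D_tau is symmetric. *)
Lemma jbd_solutionP (m : nat) (A : 'I_m -> 'M[R]_n) (W : 'M[R]_n) :
  W \in unitmx ->
  jbd_solution A tau W <-> null_space A (W *m block_label *m invmx W).
Proof.
move=> Wu; have Wtu : W^T \in unitmx by rewrite unitmx_tr.
have AP i : block_diagonal tau (W^T *m A i *m W) <->
    A i *m (W *m block_label *m invmx W) = (W *m block_label *m invmx W)^T *m A i.
  rewrite block_diagonal_comm !trmx_mul trmx_inv tr_diag_mx.
  split=> E; last first.
    have := congr1 (fun X => W^T *m X *m W) E.
    by rewrite !mulmxA mulmxV // mul1mx mulmxKV // -!mulmxA.
  have := congr1 (fun X => invmx W^T *m X *m invmx W) E.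
  by rewrite !mulmxA mulVmx // mul1mx mulmxK.
by split=> [[_ H] i|H]; [apply/AP|split=> // i; apply/AP].
Qed.

End BlockStructure.

(** * Spectrum of the conjugates of D_tau *)

Lemma char_poly_conj (F : fieldType) (n : nat) (W D : 'M[F]_n) :
  W \in unitmx -> char_poly (W *m D *m invmx W) = char_poly D.
Proof.
pose C (M : 'M[F]_n) : 'M[{poly F}]_n := map_mx polyC M.
have CM M N : C (M *m N) = C M *m C N by rewrite /C map_mxM.
move=> Wu; 
have CW : C W *m C (invmx W) = 1%:M by rewrite -CM mulmxV // /C map_mx1.
rewrite /char_poly /char_poly_mx -!/(C _).
have -> : 'X%:M - C (W *m D *m invmx W) =
    C W *m ('X%:M - C D) *m C (invmx W).
  rewrite mulmxBr mulmxBl !CM scalar_mxC -(mulmxA 'X%:M) CW.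
  by rewrite mulmx1.
by rewrite !det_mulmx mulrAC -det_mulmx CW det1 mul1r.
Qed.

Section BlockLabelSpectrum.

Variables (R : realType) (n : nat) (tau : seq nat).
Variable e : (\sum_(j < size tau) nth 0 tau j)%N = n.

Lemma char_poly_block_label (W : 'M[R]_n) : W \in unitmx ->
  char_poly (complexify (W *m block_label R e *m invmx W)) =
  \prod_(x <- [seq k%:R | k <- [seq val (block_index e i) | i <- enum 'I_n]])
    ('X - x%:P).
Proof.
move=> Wu; rewrite /complexify -map_char_poly char_poly_conj //.
rewrite char_poly_trig ?diag_mx_is_trig // rmorph_prod /= !big_map.
apply: eq_bigr => i _.
by rewrite !mxE eqxx mulr1n rmorphB /= map_polyX map_polyC /= rmorph_nat.
Qed.

(** The eigenvalues are block numbers, hence real, so singletons form an optimal splitting.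
    Positivity of the parts makes every k below [size tau] occur. *)
Lemma opt_eigenvalue_partition_block_label (W : 'M[R]_n) :
  W \in unitmx -> all (fun k => 0 < k)%N tau ->
  opt_eigenvalue_partition (W *m block_label R e *m invmx W) tau.
Proof.
move=> Wu tau_gt0; have natI : injective (fun k => k%:R : R[i]).
  by move=> k l /eqP; rewrite eqr_nat => /eqP.
pose P : seq (seq R[i]) := [seq [:: k%:R] | k <- iota 0 (size tau)].
have flattenP : flatten P = [seq k%:R | k <- iota 0 (size tau)].
  by rewrite /P; elim: (iota _ _) => //= k s ->.
exists P; split; last 2 first.
- by move=> _ /mapP[k _ ->]; left; exists k%:R; rewrite ?realn.
- rewrite /block_multiplicities -map_comp -[LHS](mkseq_nth 0%N).
  apply: eq_map => k /=; rewrite big_seq1 /alg_mult char_poly_block_label //.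
  rewrite mu_prod_XsubC count_map -(count_block_index e).
  by apply: eq_count => l /=; rewrite (inj_eq natI).
split; rewrite ?flattenP ?map_inj_uniq ?iota_uniq //.
- move=> x; rewrite [RHS]eigenvalue_root_char char_poly_block_label //.
  rewrite root_prod_XsubC; apply/mapP/mapP => -[k ks ->]; exists k => //.
    rewrite -has_pred1 has_count count_block_index.
    move: ks; rewrite mem_iota => kt.
    by apply: (allP tau_gt0); rewrite mem_nth.
  by case/mapP: ks => i _ ->; rewrite mem_iota ltn_ord.
- by move=> _ /mapP[k _ ->].
by move=> _ /mapP[k _ ->] x; rewrite !inE => /eqP->; rewrite conjC_nat.
Qed.

End BlockLabelSpectrum.

(** * Stability of the null space under polynomials *)

Lemma null_space_horner_mx (R : realType) (m n : nat) (A : 'I_m -> 'M[R]_n.+1)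
    (Z : 'M[R]_n.+1) (g : {poly R}) :
  null_space A Z -> null_space A (horner_mx Z g).
Proof.
move=> AZ i; elim/poly_ind: g => [|p c IHp].
  by rewrite rmorph0 trmx0 mulmx0 mul0mx.
rewrite rmorphD /= [_^T]raddfD /= mulmxDr mulmxDl horner_mx_C tr_scalar_mx.
rewrite scalar_mxC; congr (_ + _).
(* The factors are swapped on one side only, as transposition reverses products: A Z p(Z) = Z^T A
   p(Z) = Z^T p(Z)^T A. *)
rewrite {1}mulrC !rmorphM /= horner_mx_X trmx_mul -mulmxA -IHp.
by rewrite [LHS]mulmxA AZ mulmxA.
Qed.

(** * Real polynomials with conjugation-closed roots *)

(** The real quadratic whose roots are x and its conjugate. A real x gives a double root, so real
    and non-real eigenvalues are treated alike. *)
Definition conj_quad (R : rcfType) (x : R[i]) : {poly R} :=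
  ('X - (complex.Re x)%:P) ^+ 2 + (complex.Im x ^+ 2)%:P.

(** Both conjugates of x give the squared norm of x when multiplied by x. *)
Lemma conjC_conjc (R : rcfType) (x : R[i]) : x^* = conjc x.
Proof.
have [->|x0] := eqVneq x 0; first by rewrite !rmorph0.
by apply: (mulfI x0); rewrite -normCK sqr_normc.
Qed.

Lemma map_conj_quad (R : rcfType) (x : R[i]) :
  map_poly (real_complex R) (conj_quad x) = ('X - x%:P) * ('X - (x^*)%:P).
Proof.
rewrite [X in ('X - X%:P) * _]complexE /conj_quad.
rewrite rmorphD rmorphXn rmorphB /= map_polyX !map_polyC /=.
have i2 : ('i%C : R[i]) ^+ 2 = -1 by rewrite sqr_i.
have -> : x^* = (complex.Re x)%:C%C - 'i%C * (complex.Im x)%:C%C.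
  by rewrite conjC_conjc; case: x => a b; simpc.
have -> : ((complex.Im x ^+ 2)%:C)%C = - ('i%C * (complex.Im x)%:C%C) ^+ 2 :> R[i].
  by rewrite exprMn i2 mulN1r opprK rmorphXn.
by rewrite rmorphN rmorphXn rmorphB rmorphD /=; ring.
Qed.

(** If [s] is duplicate-free and closed under conjugation, this is the square of the product of the
    X - x; only its set of roots matters below. *)
Definition block_poly (R : rcfType) (s : seq R[i]) : {poly R} :=
  \prod_(x <- s) conj_quad x.

Lemma root_block_poly (R : rcfType) (s : seq R[i]) (x : R[i]) :
  {in s, forall y, y^* \in s} ->
  root (map_poly (real_complex R) (block_poly s)) x = (x \in s).
Proof.
move=> sJ; rewrite rmorph_prod /= (eq_bigr _ (fun y _ => map_conj_quad y)).
rewrite big_split /= rootM root_prod_XsubC orb_idr // => xs.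
have : root (\prod_(y <- [seq z^* | z <- s]) ('X - y%:P)) x by rewrite big_map.
by rewrite root_prod_XsubC => /mapP[y /sJ ys ->].
Qed.

(** * Disjoint subsets and reordered eigenbases *)

Lemma uniq_flatten_nth (T : eqType) (P : seq (seq T)) (x : T) (j k : nat) :
  uniq (flatten P) -> x \in nth [::] P j -> x \in nth [::] P k -> j = k.
Proof.
elim: P j k => [|s P IHP] [|j] [|k] //=; rewrite ?nth_nil // cat_uniq.
- case/and3P=> _ /hasPn sP _ xs xk; have /sP/negP[] // : x \in flatten P.
  apply/flattenP; exists (nth [::] P k) => //; apply: mem_nth.
  by rewrite ltnNge; apply: contraTN xk => /(nth_default _) ->.
- case/and3P=> _ /hasPn sP _ xk xs; have /sP/negP[] // : x \in flatten P.
  apply/flattenP; exists (nth [::] P j) => //; apply: mem_nth.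
  by rewrite ltnNge; apply: contraTN xk => /(nth_default _) ->.
by case/and3P=> _ _ uP xj xk; rewrite (IHP j k).
Qed.

(** Permuting the columns of the eigenbasis V permutes the diagonal entries accordingly. *)
Lemma diag_mx_permute (F : fieldType) (n : nat) (G V : 'M[F]_n) (d c : 'rV[F]_n) :
  V \in unitmx -> G = V *m diag_mx d *m invmx V ->
  perm_eq [seq d 0 i | i <- enum 'I_n] [seq c 0 i | i <- enum 'I_n] ->
  exists2 W, W \in unitmx & G = W *m diag_mx c *m invmx W.
Proof.
move=> Vu -> /perm_eq_enum_perm[s ds]; have su := unitmx_perm F s.
have Wu : V *m invmx (perm_mx s) \in unitmx by rewrite unitmx_mul Vu unitmx_inv.
exists (V *m invmx (perm_mx s)) => //; apply: (canRL (mulmxK Wu)).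
have sd : perm_mx s *m diag_mx d = diag_mx c *m perm_mx s.
  apply/matrixP => i j; rewrite -row_permE mul_diag_mx !mxE ds.
  by rewrite mulr_natr.
by rewrite mulmxA mulmxKV // -!mulmxA; congr (_ *m _);
  apply: (canRL (mulKmx su)); rewrite mulmxA sd mulmxK.
Qed.

(** * Eigenvalue partitions as counts *)

Section EigenvaluePartition.

Variables (R : realType) (n : nat) (Z : 'M[R]_n) (P : seq (seq R[i])).
Variable xs : seq R[i].
Hypothesis Zxs : char_poly (complexify Z) = \prod_(x <- xs) ('X - x%:P).
Hypothesis ZP : spectrum_split Z P.

Lemma mem_flatten_spectrum x : (x \in flatten P) = (x \in xs).
Proof.
have [-> _ _ _] := ZP.
by rewrite [LHS]eigenvalue_root_char Zxs root_prod_XsubC.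
Qed.

(** The list [xs] repeats each eigenvalue according to its algebraic multiplicity, so sums of
    multiplicities become counts. *)
Lemma block_multiplicitiesE :
  block_multiplicities Z P = [seq count [in s] xs | s <- P].
Proof.
have [_ uP _ _] := ZP; apply/eq_in_map => s sP; rewrite -sum_count_mem.
  by apply: eq_bigr => x _; rewrite /alg_mult Zxs mu_prod_XsubC.
elim: P uP s sP => //= s' P' IH; rewrite cat_uniq => /and3P[us' _ uP'] s.
by rewrite in_cons => /predU1P[->|/IH->].
Qed.

Lemma int_partition_block_multiplicities :
  int_partition n (block_multiplicities Z P).
Proof.
have [_ uP P0 _] := ZP; apply/andP; split.
  rewrite block_multiplicitiesE; apply/allP => _ /mapP[s sP ->].
  rewrite -has_count; have := P0 s sP; case: s sP => // x s sP _.
  apply/hasP; exists x; rewrite /= ?mem_head // -mem_flatten_spectrum.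
  by apply/flattenP; exists (x :: s); rewrite ?mem_head.
have -> : sumn (block_multiplicities Z P) = count [in flatten P] xs.
  rewrite -sum_count_mem // big_flatten sumnE /block_multiplicities big_map.
  apply: eq_bigr => s _; apply: eq_bigr => x _.
  by rewrite /alg_mult Zxs mu_prod_XsubC.
have : all [in flatten P] xs.
  by apply/allP => x; rewrite /= mem_flatten_spectrum.
rewrite all_count => /eqP->.
by rewrite -eqSS -(size_prod_XsubC xs id) -Zxs size_char_poly.
Qed.

End EigenvaluePartition.

(** * Interpolation on the spectrum *)

Lemma exists_block_interpolation (R : realType) (n : nat) (Z : 'M[R]_n.+1)
    (P : seq (seq R[i])) : spectrum_split Z P ->
  exists g : {poly R},
    char_poly Z %| \prod_(k <- iota 0 (size P)) (g - k%:R%:P) /\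
    forall k, {in nth [::] P k, forall x,
      (map_poly (real_complex R) g).[x] = k%:R}.
Proof.
move=> ZP; have [_ uP _ PJ] := ZP.
pose rp k := block_poly (nth [::] P k).
have nthP k x : x \in nth [::] P k -> (k < size P)%N.
  by apply: contraTltn => /(nth_default _) ->.
have root_rp k x : root (map_poly (real_complex R) (rp k)) x =
    (x \in nth [::] P k).
  apply: root_block_poly; have [kP|Pk] := ltnP k (size P).
    exact/PJ/mem_nth.
  by rewrite nth_default.
have cop : {in iota 0 (size P) &, forall j k, j != k ->
    coprimep (rp j ^+ n.+1) (rp k ^+ n.+1)}.
  move=> j k _ _ njk; apply/coprimep_expl/coprimep_expr.
  (* Coprimality is tested over the complex numbers, where a common root would lie in two disjoint
     subsets. *)
  rewrite -(coprimep_map (real_complex R)).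
  apply: Pdiv.ClosedField.root_coprimep => x; rewrite root_rp => xj.
  apply: contraNneq njk => /eqP; rewrite -[_ == _]/(root _ _) root_rp => xk.
  by apply/eqP; apply: uniq_flatten_nth uP xj xk.
have [g gP] := poly_chinese (fun k => k%:R%:P) (iota_uniq 0 (size P)) cop.
have [xs Zxs] := closed_field_poly_normal (char_poly (complexify Z)).
rewrite (eqP (char_poly_monic _)) scale1r in Zxs.
exists g; split=> [|k x xk]; last first.
  have kP := nthP k x xk.
  have : map_poly (real_complex R) (rp k ^+ n.+1) %|
         map_poly (real_complex R) (g - k%:R%:P).
    by rewrite dvdp_map gP // mem_iota.
  rewrite rmorphXn exprS => rp_g.
  have : root (map_poly (real_complex R) (g - k%:R%:P)) x.
    rewrite -dvdp_XsubCl; apply: dvdp_trans rp_g.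
    by rewrite dvdp_mulr // dvdp_XsubCl root_rp.
  rewrite rmorphB /= map_polyC /= rmorph_nat /root !hornerE subr_eq0.
  by move/eqP.
(* Each modulus divides its factor g - k, so it suffices that the characteristic polynomial divides
   the product of the moduli. *)
apply: (@dvdp_trans _ (\prod_(k <- iota 0 (size P)) rp k ^+ n.+1)); last first.
  rewrite big_seq [X in _ %| X]big_seq.
  by apply: (big_ind2 (fun p q => p %| q)) => // *; rewrite ?dvdp_mul ?gP.
have size_xs : size xs = n.+1.
  by apply/eqP; rewrite -eqSS -(size_prod_XsubC xs id) -Zxs size_char_poly.
rewrite prodrXl -(dvdp_map (real_complex R)) map_char_poly Zxs.
rewrite rmorphXn -size_xs /=.
(* Every eigenvalue is a root of the product q of the block polynomials. Each of the n+1 linear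
   factors therefore divides one copy of q, which is why the exponent n+1 suffices whatever the
   multiplicities. *)
have : {in xs, forall x, root (map_poly (real_complex R)
    (\prod_(k <- iota 0 (size P)) rp k)) x}.
  move=> x; rewrite -(mem_flatten_spectrum Zxs ZP) => /flattenP[s sP xs'].
  rewrite rmorph_prod /= (big_rem (index s P)) ?mem_iota ?index_mem //= rootM.
  by rewrite root_rp nth_index // xs'.
move: (map_poly _ (\prod_(k <- _) _)) => q; elim: (xs) => [|x s IHs] qs.
  by rewrite big_nil.
rewrite big_cons exprS dvdp_mul ?dvdp_XsubCl ?qs ?mem_head // IHs //.
by move=> y ys; rewrite qs // in_cons ys orbT.
Qed.

(** * Conjugating g(Z) to D_tau *)

Lemma horner_mx_block_label (R : realType) (n : nat) (Z : 'M[R]_n.+1)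
    (P : seq (seq R[i])) (tau := block_multiplicities Z P)
    (e : (\sum_(j < size tau) nth 0 tau j)%N = n.+1) :
  spectrum_split Z P ->
  exists g W, W \in unitmx /\ horner_mx Z g = W *m block_label R e *m invmx W.
Proof.
move=> ZP; have [_ uP _ _] := ZP.
have [g [Zg gP]] := exists_block_interpolation ZP; exists g.
have [xs Zxs] := closed_field_poly_normal (char_poly (complexify Z)).
rewrite (eqP (char_poly_monic _)) scale1r in Zxs.
have natI : injective (fun k => k%:R : R).
  by move=> k l /eqP; rewrite eqr_nat => /eqP.
have [V Vu /diagonalizable_forPex[d /(simmxLR Vu) Gd]] :
    diagonalizable (horner_mx Z g).
  apply/diagonalizableP; exists [seq k%:R | k <- iota 0 (size P)].
    by rewrite map_inj_uniq ?iota_uniq.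
  (* By Cayley-Hamilton the product of the g(Z) - k vanishes, so the minimal polynomial divides a
     product of distinct real linear factors. *)
  apply: mxminpoly_min; rewrite big_map rmorph_prod /=.
  under eq_bigr => k _ do
    rewrite rmorphB /= horner_mx_X horner_mx_C -(horner_mx_C Z) -rmorphB /=.
  rewrite -rmorph_prod /=; case/dvdpP: Zg => q ->.
  by rewrite rmorphM /= Cayley_Hamilton mulr0.
rewrite mxpoly.conjumx ?unitmx_inv // in Gd.
pose idx x := find (fun s : seq R[i] => x \in s) P.
have idxP x : x \in xs -> x \in nth [::] P (idx x).
  rewrite -(mem_flatten_spectrum Zxs ZP) => /flattenP[s sP xs'].
  by apply: (@nth_find _ [::] (fun s : seq R[i] => x \in s)); apply/hasP; exists s.
suff dperm : perm_eq [seq d 0 i | i <- enum 'I_n.+1]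
    [seq (\row_i (block_index e i)%:R : 'rV[R]_n.+1) 0 i | i <- enum 'I_n.+1].
  have [|W Wu GW] := diag_mx_permute _ Gd dperm; first by rewrite unitmx_inv.
  by exists W.
(* Each k occurs tau_k times on both sides: as the subset number of eigenvalues with multiplicity,
   and as a block number of indices. *)
have idx_perm : perm_eq [seq idx x | x <- xs]
    [seq val (block_index e i) | i <- enum 'I_n.+1].
  apply/allP => k _ /=; rewrite count_block_index count_map.
  have -> : nth 0%N tau k = count [in nth [::] P k] xs.
    rewrite /tau (block_multiplicitiesE Zxs ZP).
    have [kP|Pk] := ltnP k (size P); first by rewrite (nth_map [::]).
    by rewrite !nth_default ?size_map // count_pred0.
  apply/eqP/eq_in_count => x xxs /=.
  apply/eqP/idP => [<-|xk]; first exact: idxP.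
  exact: uniq_flatten_nth uP (idxP x xxs) xk.
have Zd : char_poly (complexify (horner_mx Z g)) =
    \prod_(x <- [seq real_complex R (d 0 i) | i <- enum 'I_n.+1]) ('X - x%:P).
  rewrite /complexify -map_char_poly Gd.
  rewrite char_poly_conj ?unitmx_inv // char_poly_trig ?diag_mx_is_trig //.
  rewrite rmorph_prod /= !big_map; apply: eq_bigr => i _.
  by rewrite !mxE eqxx mulr1n rmorphB /= map_polyX map_polyC.
(* The characteristic polynomial of g(Z) is computed from its diagonal form and by spectral mapping;
   unique factorization then matches the two lists of roots. *)
have : \prod_(x <- [seq real_complex R (d 0 i) | i <- enum 'I_n.+1]) ('X - x%:P)
    = \prod_(x <- [seq (idx x)%:R | x <- xs]) ('X - x%:P).
  rewrite -Zd /complexify map_horner_mx (char_poly_horner_mx _ Zxs) big_map.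
  by rewrite !big_seq; apply: eq_bigr => x /idxP/gP ->.
move/prod_XsubC_eq => dxs; apply: (perm_map_inj (@complexI R)).
rewrite -map_comp (perm_trans dxs) //.
have := perm_map (fun k => k%:R : R[i]) idx_perm.
rewrite -!map_comp; congr perm_eq; apply: eq_map => i /=.
by rewrite mxE rmorph_nat.
Qed.

(** * Solvability and eigenvalue partitions *)

Lemma jbd_solution_of_eigenvalue_partition (R : realType) (m n : nat)
    (A : 'I_m -> 'M[R]_n) (Z : 'M[R]_n) (tau : seq nat) : (0 < n)%N ->
  null_space A Z -> eigenvalue_partition Z tau ->
  int_partition n tau /\ exists W, jbd_solution A tau W.
Proof.
case: n A Z => // n A Z _ AZ [P ZP ->].
have [xs Zxs] := closed_field_poly_normal (char_poly (complexify Z)).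
rewrite (eqP (char_poly_monic _)) scale1r in Zxs.
have tau_n := int_partition_block_multiplicities Zxs ZP.
split=> //; have e := sum_nth_partition tau_n.
have [g [W [Wu Eg]]] := horner_mx_block_label e ZP.
exists W; apply/(jbd_solutionP e) => //; rewrite -Eg.
exact: null_space_horner_mx.
Qed.

Lemma opt_eigenvalue_partition_of_jbd_solution (R : realType) (m n : nat)
    (A : 'I_m -> 'M[R]_n) (W : 'M[R]_n) (tau : seq nat) :
  int_partition n tau -> jbd_solution A tau W ->
  exists2 Z, null_space A Z & opt_eigenvalue_partition Z tau.
Proof.
move=> tau_n AW; have e := sum_nth_partition tau_n; have [Wu _] := AW.
exists (W *m block_label R e *m invmx W); first exact/(jbd_solutionP e).
by apply: opt_eigenvalue_partition_block_label => //; case/andP: tau_n.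
Qed.

Lemma opt_eigenvalue_partitionW (R : realType) (n : nat) (Z : 'M[R]_n)
    (tau : seq nat) :
  opt_eigenvalue_partition Z tau -> eigenvalue_partition Z tau.
Proof. by case=> P [ZP _ ->]; exists P. Qed.

(** Reordering the subsets of the splitting reorders the multiplicities in the same way. *)
Lemma eigenvalue_partition_perm (R : realType) (n : nat) (Z : 'M[R]_n)
    (zeta tau : seq nat) :
  perm_eq zeta tau -> eigenvalue_partition Z zeta -> eigenvalue_partition Z tau.
Proof.
move=> zt [P [P1 P2 P3 P4] zP]; rewrite zP perm_sym in zt.
have /(perm_iotaP 0%N)[Is IsP ->] := zt.
pose Q := [seq nth [::] P i | i <- Is].
have QP : perm_eq Q P.
  rewrite /Q -[X in perm_eq _ X](mkseq_nth [::]); apply: perm_map.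
  by rewrite size_map in IsP.
exists Q.
  split; rewrite ?(perm_uniq (perm_flatten QP)) //.
  - by move=> x; rewrite (perm_mem (perm_flatten QP)) P1.
  - by move=> s; rewrite (perm_mem QP); apply: P3.
  - by move=> s; rewrite (perm_mem QP); apply: P4.
rewrite /Q /block_multiplicities -map_comp; apply/eq_in_map => i.
rewrite (perm_mem IsP) mem_iota size_map => /andP[_ iP] /=.
by rewrite (nth_map [::]).
Qed.

Theorem theorem2p4 (R : realType) (m n : nat) (A : 'I_m -> 'M[R]_n)
    (tau : seq nat) (n_gt0 : (0 < n)%N) (tau_n : int_partition n tau) :
  (exists W : 'M[R]_n, gjbd_solution A tau W) <->
  ((exists Z : 'M[R]_n, null_space A Z /\
      exists zeta : seq nat, eigenvalue_partition Z zeta /\ perm_eq zeta tau) /\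
   ~ (exists Zt : 'M[R]_n, null_space A Zt /\
      exists zeta : seq nat, opt_eigenvalue_partition Zt zeta /\
        (size tau < size zeta)%N)).
Proof.
split=> [[W [_ AW tau_max]]|[[Z [AZ [zeta [Zzeta zeta_tau]]]] no_better]].
  split.
    have [Z AZ Ztau] := opt_eigenvalue_partition_of_jbd_solution tau_n AW.
    exists Z; split=> //; exists tau; split=> //.
    exact: opt_eigenvalue_partitionW.
  (* A longer optimal partition would itself be solvable, against the maximality of tau. *)
  case=> Zt [AZt [zeta [/opt_eigenvalue_partitionW Zzeta]]].
  have [zeta_n AW'] := jbd_solution_of_eigenvalue_partition n_gt0 AZt Zzeta.
  by rewrite ltnNge (tau_max zeta).
have Ztau := eigenvalue_partition_perm zeta_tau Zzeta.
have [_ [W AW]] := jbd_solution_of_eigenvalue_partition n_gt0 AZ Ztau.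
(* A solvable tau' with more parts would be the optimal eigenvalue partition of a matrix in the null
   space, which is excluded. *)
exists W; split=> // tau' tau'_n [W' AW']; rewrite leqNgt; apply/negP => lt_tau.
have [Zt AZt Ztau'] := opt_eigenvalue_partition_of_jbd_solution tau'_n AW'.
by apply: no_better; exists Zt; split=> //; exists tau'.
Qed.
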